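(* There exists an absolute constant $c>0$ such that the following holds. Let $\mathcal{G}=(G_1,\dots,G_L)$ be a temporal graph with $n$ vertices, every snapshot of which is connected, with lifetime $L\geq 12n^{3.5}+4n$, and let $s$ be any given starting vertex. Then there exists an exploration of $\mathcal{G}$ starting at $s$ that traverses at most $c\,n^{1.5}$ edges.
   Context: A temporal graph $\mathcal{G}$ with (finite) vertex set $V$, $|V|=n$, and lifetime $L$ is a sequence $(G_1,\dots,G_L)$ of static undirected graphs $G_i=(V,E_i)$; $G_i$ is the snapshot at time step $i$. All temporal graphs are assumed constantly connected: every $G_i$ is connected. A (strict) journey from $u$ to $v$ is a sequence $((v_0,v_1),t_1),((v_1,v_2),t_2),\dots,((v_{l-1},v_l),t_l)$ with $v_0=u$, $v_l=v$, $1\le t_1<t_2<\dots<t_l\le L$ (the time steps need not be consecutive) and $\{v_{i-1},v_i\}\in E_{t_i}$ for all $i$; thus at each time step an agent either stays on its vertex or traverses one edge of the current snapshot. The number of edges traversed (the length) is $l$, counted with multiplicity; $l=0$ is allowed if $u=v$. The journey visits the vertices $v_0,\dots,v_l$. An exploration starting at $s$ is a strict journey with $v_0=s$ that visits all vertices of $V$. *)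

(* Defs.v *)
From mathcomp Require Import all_boot.

Set Implicit Arguments.
Unset Strict Implicit.
Unset Printing Implicit Defensive.

Record sgraph (V : finType) := SGraph {
  adj :> rel V;
  adj_sym : symmetric adj;
  adj_irrefl : irreflexive adj }.

Definition connected (V : finType) (G : sgraph V) : Prop :=
  forall u v : V, connect G u v.

(* The snapshot [tnth G t] is the one at time step [t.+1]. *)
Definition tgraph (V : finType) (L : nat) := L.-tuple (sgraph V).

Definition constantly_connected (V : finType) (L : nat) (G : tgraph V L) : Prop :=
  forall t : 'I_L, connected (tnth G t).

Section Journeys.
Variables (V : finType) (L : nat).

(* [((v, w), t)] is the traversal, from v to w, of the edge {v, w} of the
   snapshot of index t. *)
Definition traversal := ((V * V) * 'I_L)%type.

Definition origin (e : traversal) : V := e.1.1.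
Definition target (e : traversal) : V := e.1.2.
Definition time (e : traversal) : 'I_L := e.2.

Implicit Types (G : tgraph V L) (J : seq traversal).

(* v_0, ..., v_l for a journey starting at u *)
Definition visited (u : V) J : seq V := u :: map target J.

(* As [belast u (map target J)] lists v_0, ..., v_{l-1}, the first condition says
   that each traversal starts where the previous one ended, the first one at u. *)
Definition journey G (u v : V) J : Prop :=
  [/\ map origin J = belast u (map target J),
      last u (map target J) = v,
      sorted ltn (map (val \o time) J) &
      {in J, forall e, tnth G (time e) (origin e) (target e)}].

Definition exploration G (s : V) J : Prop :=
  (exists v : V, journey G s v J) /\ (forall w : V, w \in visited s J).

End Journeys.

(* Main.v *)
Require Import Defs.
From mathcomp Require Import all_boot all_order all_algebra.
From mathcomp Require Import reals exp boolp zify lra.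
Import Order.TTheory GRing.Theory Num.Theory.
Local Open Scope ring_scope.

(* If the set U of unvisited vertices has m elements, then for r of order
   n / sqrt m and j of order sqrt m some journey of j hops, each of O(r) edges,
   visits j vertices of U; after a first leg of at most n edges to its start it
   costs O(n) edges, and since each such round lowers sqrt m by a constant, at
   most O(sqrt n) rounds are needed.

   To find the journey, split the time into phases and record for each y in U
   the largest number of vertices of U visited by a hop journey ending at y. If
   all records stay below j, then in some phase half of them do not change, and
   at some time t within this phase, for half of the remaining vertices x, one
   more step changes neither the sets reached from x with d <= r edges nor those
   from which x can still be reached. Then the ball of radius r around x in the
   snapshot at t consists of at least r + 1 vertices to which x can go and from
   which it can come back. If z lies in the balls of several such x, each of
   these can be reached from the one with the largest record, hence has been
   visited by its journey: at most j balls contain z. Counting pairs (x, z)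
   bounds m by 4 j n / (r + 1), a contradiction. *)

Set Implicit Arguments.
Unset Strict Implicit.

Local Open Scope nat_scope.

(** * Counting lemmas *)

(** Each [f x] increases at most [M] times before [K]. If more than half of [X] changed at every
    step, there would be more than [K * #|X| / 2 >= M * #|X|] changes. *)
Lemma half_unchanged (T : finType) (X : {set T}) (f : T -> nat -> nat) (M K : nat) :
    (forall x t, f x t <= f x t.+1) -> (forall x, x \in X -> f x K <= M) ->
    0 < K -> 2 * M <= K ->
  exists2 t, t < K & #|X| <= 2 * #|[set x in X | f x t.+1 == f x t]|.
Proof.
move=> fS fM K0 MK; apply: contrapT => H.
have ch t : t < K -> #|X| < 2 * \sum_(x in X) (f x t != f x t.+1).
  move=> tK; rewrite ltnNge; apply/negP => Hc; apply: H; exists t => //.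
  have := cardsID [set x | f x t.+1 == f x t] X.
  have -> : X :&: [set x | f x t.+1 == f x t] = [set x in X | f x t.+1 == f x t].
    by apply/setP => x; rewrite !inE.
  have -> : #|X :\: [set x | f x t.+1 == f x t]|
            = \sum_(x in X) (f x t != f x t.+1).
    rewrite -sum1_card big_mkcond [RHS]big_mkcond; apply: eq_bigr => x _.
    by rewrite !inE eq_sym; case: (x \in X); case: (_ == _).
  move: Hc; move: #|_| #|_| (\sum_(x in X) _) => p q u; lia.
have tel x k : \sum_(t < k) (f x t != f x t.+1) <= f x k.
  elim: k => [|k IH]; first by rewrite big_ord0.
  rewrite big_ord_recr /=; have := fS x k.
  move: (\sum_(_ < k) _) IH => p; case: eqVneq => /= h; lia.
have H1 : \sum_(t < K) (#|X|).+1 <= \sum_(t < K) 2 * \sum_(x in X) (f x t != f x t.+1).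
  by apply: leq_sum => t _; apply: ch.
have H2 : \sum_(t < K) \sum_(x in X) (f x t != f x t.+1) <= #|X| * M.
  rewrite exchange_big /= -sum_nat_const; apply: leq_sum => x xX.
  exact: leq_trans (tel x K) (fM x xX).
move: H1; rewrite -big_distrr /= sum_nat_const card_ord.
by move: H2; move: (\sum_(_ < K) _) #|X| => p q; clear -K0 MK; nia.
Qed.

(** By connectedness an edge leaves [C i] unless [C i] is everything, so each step adds a vertex.
    The index is time in [reach_all], but distance in one fixed snapshot in [stable_balls]. *)
Lemma card_growth (V : finType) (e : nat -> rel V) (C : nat -> {set V}) (r d : nat) :
    (forall i x y, connect (e i) x y) -> C 0 != set0 ->
    (forall i, i < r -> C i \subset C i.+1) ->
    (forall i x y, i < r -> x \in C i -> e i x y -> y \in C i.+1) ->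
  d <= r -> d < #|V| -> d < #|C d|.
Proof.
move=> conn C0 CS Ce; elim: d => [|d IH] dr dV; first by rewrite card_gt0.
have := IH (ltnW dr) (ltnW dV) => Hd.
have := subset_leqif_cards (CS d dr) => -[le eq].
rewrite ltnNge; apply/negP => Hle.
have Ceq : C d = C d.+1 by apply/eqP; rewrite -eq; apply/eqP; lia.
have [x xC] : exists x, x \in C d by apply/set0Pn; rewrite -card_gt0; lia.
have sub (s : seq V) u : u \in C d -> path (e d) u s -> last u s \in C d.
  elim: s u => //= w s IHs u uC /andP[euw]; apply: IHs.
  by rewrite Ceq; apply: (Ce _ u).
have : #|V| <= #|C d|.
  rewrite -cardsT; apply: subset_leq_card; apply/subsetP => y _.
  by have /connectP[s ps ->] := conn d x y; apply: sub.
rewrite Ceq; lia.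
Qed.

(** * Journeys with a start time and a deadline *)

Section Trips.
Variables (V : finType) (E : nat -> rel V).

(* [J] lists the pairs (time of traversal, vertex entered) of a journey from
   [x] to [y] whose traversals all take place at times t with a <= t < b. *)
Fixpoint trip (a : nat) (x : V) (J : seq (nat * V)) (b : nat) (y : V) : bool :=
  match J with
  | [::] => (a <= b) && (x == y)
  | e :: J' => [&& a <= e.1, E e.1 x e.2 & trip e.1.+1 e.2 J' b y]
  end.

Definition reach a x b y d := exists2 J, trip a x J b y & size J <= d.

Definition tour (U : {set V}) a x T l :=
  exists J y, [/\ trip a x J (a + T) y, size J <= l &
                  forall w, w \in U -> w \in x :: map snd J].

Lemma trip_cat a x J b y J' c z :
  trip a x J b y -> trip b y J' c z -> trip a x (J ++ J') c z.
Proof.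
elim: J a x => [|e J IH] a x /=.
  move=> /andP[ab /eqP->]; case: J' => [|e' J'] /=.
    by move=> /andP[bc ->]; rewrite (leq_trans ab bc).
  by move=> /and3P[be -> ->]; rewrite (leq_trans ab be).
by move=> /and3P[-> -> t] /(IH _ _ t).
Qed.

Lemma trip_stay a b x : a <= b -> trip a x [::] b x.
Proof. by move=> /= ->; rewrite eqxx. Qed.

Lemma trip_leq_end a x J b c y : b <= c -> trip a x J b y -> trip a x J c y.
Proof. by move=> bc t; rewrite -[J]cats0; apply: trip_cat t (trip_stay _ _). Qed.

Lemma trip_last a x J b y : trip a x J b y -> last x (map snd J) = y.
Proof.
by elim: J a x => [|e J IH] a x /=; [case/andP=> _ /eqP | case/and3P=> _ _ /IH].
Qed.

Lemma mem_last_trip a x J b y : trip a x J b y -> y \in x :: map snd J.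
Proof. by move=> /trip_last <-; apply: mem_last. Qed.

Lemma reach_trans a x b y d c z e :
  reach a x b y d -> reach b y c z e -> reach a x c z (d + e).
Proof.
move=> [J t s] [J' t' s']; exists (J ++ J'); first exact: trip_cat t t'.
by rewrite size_cat leq_add.
Qed.

Lemma reach_stay a b x d : a <= b -> reach a x b x d.
Proof. by move=> ab; exists [::] => //; apply: trip_stay. Qed.

Lemma reach_leq a x b y d e : d <= e -> reach a x b y d -> reach a x b y e.
Proof. by move=> de [J t s]; exists J => //; apply: leq_trans de. Qed.

Lemma reach_edge t x y : E t x y -> reach t x t.+1 y 1.
Proof. by move=> e; exists [:: (t, y)] => //=; rewrite e leqnn eqxx leqnn. Qed.

Lemma tour_leq U a x T l T' l' :
  T <= T' -> l <= l' -> tour U a x T l -> tour U a x T' l'.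
Proof.
move=> TT ll [J [y [t s v]]]; exists J, y; split=> //; last exact: leq_trans ll.
by apply: trip_leq_end t; rewrite leq_add2l.
Qed.

Lemma tour_cat (U W : {set V}) a x J b y T l :
    trip a x J b y -> (forall w, w \in W -> w \in x :: map snd J) ->
    tour (U :\: W) b y T l ->
  tour U a x (b - a + T) (size J + l).
Proof.
move=> t v [J' [z [t' s' v']]]; exists (J ++ J'), z; split.
- apply: trip_leq_end (trip_cat t t'); lia.
- by rewrite size_cat leq_add2l.
move=> w wU; rewrite map_cat -cat_cons mem_cat; apply/orP.
have [/v|wW] := boolP (w \in W); first by left.
have := v' w; rewrite in_setD wW wU => /(_ isT); rewrite inE => /predU1P[->|].
  by left; apply: mem_last_trip t.
by right.
Qed.

Hypothesis E_sym : forall t, symmetric (E t).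
Hypothesis E_conn : forall t x y, connect (E t) x y.

(** Flooding: the set of vertices reached from [x] gains a vertex at every time step until it is
    everything. *)
Lemma reach_all a x y : reach a x (a + #|V|) y #|V|.
Proof.
pose C k := [set z | `[< reach a x (a + k) z k >]].
have CP k z : reflect (reach a x (a + k) z k) (z \in C k).
  by rewrite inE; apply: asboolP.
have V0 : 0 < #|V| by apply/card_gt0P; exists x.
have : #|V|.-1 < #|C #|V|.-1|.
  apply: (card_growth (e := fun i => E (a + i)) (r := #|V|)); try by [lia|].
  - by apply/set0Pn; exists x; apply/CP; apply: reach_stay; lia.
  - move=> i _; apply/subsetP => z /CP rz; apply/CP.
    rewrite -[i.+1]addn1; apply: reach_trans rz _; apply: reach_stay; lia.
  - move=> i u w _ /CP ru /reach_edge re; apply/CP.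
    by rewrite addnS -[i.+1]addn1; apply: reach_trans ru re.
rewrite prednK // => H.
have /eqP CT : C #|V|.-1 == [set: V] by rewrite eqEcard subsetT cardsT.
have /CP r : y \in C #|V|.-1 by rewrite CT inE.
rewrite -[X in a + X](prednK V0) -[X in reach _ _ _ _ X](prednK V0) -addn1.
by apply: reach_trans r _; apply: reach_stay; lia.
Qed.

Lemma tour_naive U a x : tour U a x (#|U| * #|V|) (#|U| * #|V|).
Proof.
move: {2}#|U| (erefl #|U|) => m; elim: m U a x => [|m IH] U a x Um.
  exists [::], x; split=> //; first by apply: trip_stay; lia.
  by move=> w; rewrite (cards0_eq Um) inE.
have [u uU] : exists u, u \in U by apply/card_gt0P; rewrite Um.
have [J t s] := reach_all a x u.
have := cardsD1 u U; rewrite uU Um => /eqP; rewrite eqSS eq_sym => /eqP Um'.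
have v w : w \in [set u] -> w \in x :: map snd J.
  by move=> /set1P->; apply: mem_last_trip t.
by apply: tour_leq (tour_cat t v (IH _ _ _ Um')); rewrite ?Um ?Um' mulSn; lia.
Qed.

(** * Balls that can be entered and left, and the journeys they yield *)

(** Where the reached sets do not change in time, crossing an edge of the snapshot at [t] uses up an
    edge but no time, so [C x] contains the ball of radius [r]. *)
Lemma stable_balls (X : {set V}) (a r : nat) : r < #|V| ->
  exists (t : nat) (Y : {set V}) (C : V -> {set V}),
  [/\ Y \subset X, #|X| <= 2 * #|Y|,
      forall x, x \in Y -> r < #|C x| &
      forall x z, z \in C x ->
        reach a x t z r /\ reach t z (a + 4 * r.+1 * #|V|) x r].
Proof.
move=> rV; set b := a + _.
(* The journeys out of [x] reach more vertices as [t] grows, and those back to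
   [x] start from fewer. *)
pose A x t d := [set z | `[< reach a x t z d >]].
pose B x t d := [set z | `[< reach t z b x d >]].
have AP x t d z : reflect (reach a x t z d) (z \in A x t d).
  by rewrite inE; apply: asboolP.
have BP x t d z : reflect (reach t z b x d) (z \in B x t d).
  by rewrite inE; apply: asboolP.
have AS x t d : A x t d \subset A x t.+1 d.
  apply/subsetP => z /AP h; apply/AP; rewrite -[d]addn0.
  by apply: reach_trans h _; apply: reach_stay.
have BS x t d : B x t.+1 d \subset B x t d.
  apply/subsetP => z /BP h; apply/BP; rewrite -[d]add0n.
  by apply: reach_trans _ h; apply: reach_stay.
(* Complementing [B], which shrinks, makes every term nondecreasing in [k]. *)
pose f x k := \sum_(d < r.+1) (#|A x (a + k) d| + #|~: B x (a + k) d|).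
have fS x k : f x k <= f x k.+1.
  by apply: leq_sum => d _; rewrite addnS leq_add ?subset_leq_card ?setCS.
have fM x : x \in X -> f x (4 * r.+1 * #|V|) <= r.+1 * (2 * #|V|).
  have -> : r.+1 * (2 * #|V|) = \sum_(d < r.+1) 2 * #|V|.
    by rewrite sum_nat_const card_ord.
  by move=> _; apply: leq_sum => d _; rewrite mul2n -addnn leq_add ?max_card.
have [||k kb Xk] := half_unchanged fS fM; try by lia.
exists (a + k), [set x in X | f x k.+1 == f x k].
exists (fun x => A x (a + k) r :&: B x (a + k) r).
split=> //.
- by apply/subsetP => x; rewrite inE => /andP[].
- move=> x; rewrite inE => /andP[_ /eqP fx].
  (* If a sum of nondecreasing terms does not change, no term does; by the inclusions the sets then
     agree. *)
  have eqd d : d <= r ->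
      A x (a + k).+1 d = A x (a + k) d /\ B x (a + k).+1 d = B x (a + k) d.
    move=> dr; pose od : 'I_r.+1 := Ordinal (dr : d < r.+1).
    have : #|A x (a + k).+1 d| + #|~: B x (a + k).+1 d|
           <= #|A x (a + k) d| + #|~: B x (a + k) d|.
      move: fx; rewrite /f (bigD1 od) //= [in RHS](bigD1 od) //= addnS => fx.
      rewrite -(leq_add2r (\sum_(i < r.+1 | i != od)
         (#|A x (a + k).+1 i| + #|~: B x (a + k).+1 i|))) fx leq_add2l.
      by apply: leq_sum => i _; rewrite leq_add ?subset_leq_card ?setCS.
    have := subset_leqif_cards (AS x (a + k) d) => -[lA eA].
    have [] := @subset_leqif_cards _ (~: B x (a + k) d) (~: B x (a + k).+1 d).
      by rewrite setCS.
    move=> lB eB le.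
    split; first by apply/esym/eqP; rewrite -eA; apply/eqP; lia.
    by apply/esym/eqP; rewrite -(inj_eq (@setC_inj V)) -eB; apply/eqP; lia.
  apply: (card_growth (e := fun=> E (a + k)) (r := r)
    (C := fun d => A x (a + k) d :&: B x (a + k) d)) => //.
  + apply/set0Pn; exists x; rewrite inE; apply/andP; split.
      by apply/AP; apply: reach_stay; lia.
    by apply/BP; apply: reach_stay; rewrite /b; lia.
  + move=> i _; apply: setISS; apply/subsetP => z.
      by move=> /AP h; apply/AP; apply: reach_leq h.
    by move=> /BP h; apply/BP; apply: reach_leq h.
  (* Outwards, [w] is reached one time step later, but [A] does not change in that step. Backwards,
     the edge leads from [w] to [u], which is still in [B] one step later. *)
  + move=> i u w ir; rewrite !in_setI => /andP[/AP uA uB] euw.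
    have [_ eB] := eqd i (ltnW ir); have [eA _] := eqd i.+1 ir.
    apply/andP; split; last first.
      have : u \in B x (a + k).+1 i by rewrite eB.
      move=> /BP h; apply/BP; rewrite -add1n; apply: reach_trans h.
      by apply: reach_edge; rewrite E_sym.
    have : w \in A x (a + k).+1 i.+1.
      by apply/AP; rewrite -[i.+1]addn1; apply: reach_trans uA (reach_edge euw).
    by rewrite eA.
- by move=> x z; rewrite inE => /andP[/AP ? /BP ?].
Qed.

Lemma collect (U : {set V}) (a j r : nat) :
    0 < j -> r < #|V| -> 4 * j * #|V| < r.+1 * #|U| ->
  exists u J y (S : {set V}),
  [/\ trip a u J (a + 2 * j * (4 * r.+1 * #|V|)) y, size J <= j * (2 * r),
      S \subset U, #|S| = j & forall w, w \in S -> w \in u :: map snd J].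
Proof.
move=> j0 rV jU; set p := 4 * r.+1 * #|V|.
(* What a journey can achieve in [i] phases of length [p], at [2 * r] edges per collected vertex.
   Its start [u] is free, as a separate leg will lead there. *)
pose token i y (S : {set V}) := exists u J,
  [/\ trip a u J (a + i * p) y, size J <= #|S| * (2 * r), S \subset U, #|S| <= j &
      forall w, w \in S -> w \in u :: map snd J].
have token_leq i i' y S : i <= i' -> token i y S -> token i' y S.
  move=> ii [u [J [t ? ? ? ?]]]; exists u, J; split=> //.
  by apply: trip_leq_end t; rewrite leq_add2l leq_mul2r ii orbT.
case: (pselect (exists y S, token (2 * j) y S /\ #|S| = j)).
  move=> [y [S [[u [J [t sJ SU _ v]]] Sj]]].
  by exists u, J, y, S; split=> //; rewrite -Sj.
move=> none; exfalso.
have token_lt i y S : i <= 2 * j -> token i y S -> #|S| < j.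
  move=> ij tk; have [u [J [_ _ _ Sj _]]] := tk.
  rewrite ltn_neqAle Sj andbT; apply/eqP => Sj'.
  by apply: none; exists y, S; split=> //; apply: token_leq ij tk.
pose f y i := \max_(S : {set V} | `[< token i y S >]) #|S|.
have f_ge i y S : token i y S -> #|S| <= f y i.
  by move=> tk; apply: (@leq_bigmax_cond _ _ (fun S : {set V} => #|S|)); apply/asboolP.
have f_max i y : y \in U -> exists2 S, token i y S & f y i = #|S|.
  move=> yU; have t0 : token i y [set y].
    exists y, [::]; split=> //.
    - by apply: trip_stay; rewrite leq_addr.
    - by rewrite sub1set.
    - by rewrite cards1.
    - by move=> w /set1P->; rewrite inE.
  have [|S] := @eq_bigmax_cond _ [pred S : {set V} | `[< token i y S >]]
                 (fun S : {set V} => #|S|).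
    by apply/card_gt0P; exists [set y]; apply/asboolP.
  by move=> /asboolP tS eS; exists S => //; rewrite -eS.
(* Records bounded by [j] require [2 * j] phases. *)
have [y|y yU|||i ij] := @half_unchanged _ U f j (2 * j); try by lia.
- move=> i; apply/bigmax_leqP => S /asboolP tS; apply: f_ge.
  by apply: token_leq tS.
- by apply/bigmax_leqP => S /asboolP[u [J []]].
set Y := [set y in U | _] => UY.
have [t [X [C [XY YX C_gt C_reach]]]] := stable_balls Y (a + i * p) rV.
have XU x : x \in X -> x \in U by move=> /(subsetP XY); rewrite inE => /andP[].
(* A token at [x] can be carried to [y] during the stable phase, so it must
   have visited [y] already: otherwise the record of [y] would increase. *)
have near x y z S : x \in X -> y \in X -> z \in C x -> z \in C y ->
    f y i <= f x i -> token i x S -> f x i = #|S| -> y \in S.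
  move=> xX yX zx zy fyx tk eS; have [//|yS] := boolP (y \in S).
  have Sj := token_lt _ _ _ (ltnW ij) tk.
  have cS : #|y |: S| = #|S|.+1 by rewrite cardsU1 yS.
  have : token i.+1 y (y |: S).
    have [u [J [tJ sJ SU _ v]]] := tk.
    have [[K1 q1 k1] _] := C_reach x z zx.
    have [_ [K2 q2 k2]] := C_reach y z zy.
    have q : trip a u (J ++ (K1 ++ K2)) (a + i.+1 * p) y.
      apply: trip_cat tJ (trip_cat q1 _).
      by rewrite mulSn [p + _]addnC addnA.
    exists u, (J ++ (K1 ++ K2)); split=> //.
    (* The detour through [z] costs [r + r] edges, paid for by the new vertex [y]. *)
    - by rewrite !size_cat cS mulSn [2 * r + _]addnC leq_add // mul2n -addnn leq_add.
    - by rewrite subUset sub1set (XU _ yX).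
    - by rewrite cS.
    - move=> w /setU1P[->|/v]; first by apply: mem_last_trip q.
      by rewrite map_cat -cat_cons mem_cat => ->.
  move=> /f_ge; rewrite cS -eS.
  have /eqP -> : f y i.+1 == f y i by move: (subsetP XY _ yX); rewrite inE => /andP[].
  by move=> h; have := leq_trans h fyx; rewrite ltnn.
(* The token of the [x] with the largest record has collected all the vertices counted here. *)
have few z : #|[set x in X | z \in C x]| <= j.
  have [->|[x0 x0P]] := set_0Vmem [set x in X | z \in C x].
    by rewrite cards0.
  have [x xP xmax] :=
    @arg_maxnP _ x0 (fun x => x \in [set x in X | z \in C x]) (f ^~ i) x0P.
  have := xP; rewrite inE => /andP[xX zx].
  have [S tk eS] := f_max i x (XU _ xX).
  apply: leq_trans (ltnW (token_lt _ _ _ (ltnW ij) tk)).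
  apply: subset_leq_card; apply/subsetP => y yP.
  have := yP; rewrite inE => /andP[yX zy].
  exact: (near x y z S) (xmax y yP) tk eS.
have : r.+1 * #|X| <= #|V| * j.
  rewrite mulnC -sum_nat_const.
  apply: (@leq_trans (\sum_(x in X) #|C x|)); first by apply: leq_sum => x /C_gt.
  have -> : \sum_(x in X) #|C x| = \sum_z #|[set x in X | z \in C x]|.
    under eq_bigr do rewrite -sum1_card big_mkcond.
    rewrite exchange_big; apply: eq_bigr => z _.
    by rewrite -sum1_card -big_mkcondr; apply: eq_bigl => x; rewrite inE.
  have -> : #|V| * j = \sum_(z : V) j by rewrite sum_nat_const.
  by apply: leq_sum => z _; apply: few.
move=> XV; have : r.+1 * #|U| <= r.+1 * (4 * #|X|).
  by rewrite leq_mul2l; move: UY YX; clear; lia.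
rewrite mulnCA; move: jU XV; rewrite -mulnA [j * _]mulnC; clear.
by move: (r.+1 * _) (r.+1 * _) (_ * j); lia.
Qed.

(** * Repeated rounds *)

Lemma tour_square k (U : {set V}) a x :
  #|U| <= k ^ 2 -> tour U a x (300 * #|V| ^ 2 * k) (100 * #|V| * k).
Proof.
have V0 : 0 < #|V| by apply/card_gt0P; exists x.
elim: k U a x => [|k IH] U a x Uk.
  have := tour_naive U a x; have -> : #|U| = 0 by lia.
  by rewrite !muln0 !mul0n.
have [k16|k16] := leqP k 15.
  (* Small [k] are left to the naive tour; [k >= 16] gives [r < n] below. *)
  by apply: tour_leq (tour_naive U a x); clear -Uk k16 V0; nia.
have [Uk'|Uk'] := leqP #|U| (k ^ 2).
  by apply: tour_leq (IH U a x Uk'); rewrite leq_mul2l leqnSn orbT.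
set n := #|V| in V0 IH *.
(* [j] is the gap between consecutive squares. The factor 16 gives [4 * j * n < r.+1 * #|U|], as
   [#|U| > k ^ 2]. *)
pose r := 16 * n %/ k.+1; pose j := 2 * k + 1.
have rk : r * k.+1 <= 16 * n by apply: leq_divM.
have rk' : 16 * n < r.+1 * k.+1 by rewrite ltn_ceil.
have Un : #|U| <= n by apply: max_card.
(* Starting at [a + n] leaves time to walk from [x] to [u]. *)
have [||| u [J [y [S [t sJ SU Sj v]]]]] := @collect U (a + n) j r.
- by rewrite /j addn1.
- by clear -rk k16 V0; nia.
- by clear -rk' k16 V0 Uk'; nia.
have [J0 t0 s0] := reach_all a x u.
have tt := trip_cat t0 t.
have US : #|U :\: S| <= k ^ 2.
  have := cardsDS SU; rewrite Sj /j; clear -Uk; nia.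
have v' w : w \in S -> w \in x :: map snd (J0 ++ J).
  move=> /v; rewrite map_cat -cat_cons mem_cat inE => /predU1P[->|->].
    by rewrite (mem_last_trip t0).
  by rewrite orbT.
have kn : k < n by move: Uk' Un k16; clear; nia.
have jr : j * r.+1 <= 34 * n by move: rk kn; rewrite /j; clear; nia.
apply: tour_leq (tour_cat tt v' (IH _ _ _ US)).
- rewrite -!addnA addKn [_ * k.+1]mulnS leq_add2r.
  have -> : 2 * j * (4 * r.+1 * n) = 8 * (j * r.+1) * n by clear; lia.
  by move: jr V0; clear; nia.
- rewrite size_cat [_ * k.+1]mulnS leq_add2r; apply: leq_trans (leq_add s0 sJ) _.
  by move: jr; rewrite -/n; clear; nia.
Qed.

End Trips.

(** * Back to temporal graphs and real exponents *)

Lemma trip_journey (V : finType) (L : nat) (G : tgraph V L) (E : nat -> rel V) a x J y :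
    (forall i : 'I_L, E i =2 tnth G i) -> trip E a x J L y ->
  exists J' : seq (traversal V L),
    [/\ journey G x y J', visited x J' = x :: map snd J & size J' = size J].
Proof.
(* The lower bound on the times makes the list stay sorted when a traversal is prepended. *)
move=> EG; suff H : trip E a x J L y -> exists J' : seq (traversal V L),
    [/\ journey G x y J', map (@target V L) J' = map snd J, size J' = size J &
        all (leq a) (map (val \o @time V L) J')].
  by move=> /H[J' [jo tg sz _]]; exists J'; split=> //; rewrite /visited tg.
elim: J a x => [|e J IH] a x /=.
  by move=> /andP[_ /eqP<-]; exists [::]; split.
move=> /and3P[ae ee t].
have eL : e.1 < L by elim: (J) (e.1) (e.2) t => [|e' J' IHJ] u v /=;
  [case/andP | case/and3P => ue _ /IHJ; apply: leq_trans; apply: ltnW].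
have [J' [[o l so ed] tg sz pt]] := IH _ _ t.
exists (((x, e.2), Ordinal eL) :: J'); split.
- split=> /=.
  + by rewrite o.
  + by rewrite l.
  + by rewrite path_sortedE; [rewrite pt so | exact: ltn_trans].
  + move=> f; rewrite inE => /predU1P[->|/ed //].
    by rewrite -EG.
- by rewrite /= tg.
- by rewrite /= sz.
- rewrite /= ae; apply: sub_all pt => i; exact: leq_trans (leqW ae).
Qed.

Local Open Scope ring_scope.

Theorem theorem12 (R : realType) :
  exists c : R, 0 < c /\
    forall (n L : nat) (V : finType) (G : tgraph V L) (s : V),
      #|V| = n ->
      constantly_connected G ->
      12 * n%:R `^ (7 / 2) + 4 * n%:R <= L%:R :> R ->
      exists J : seq (traversal V L),
        exploration G s J /\ (size J)%:R <= c * n%:R `^ (3 / 2).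
Proof.
exists 200; split=> // n L V G s Vn G_conn nL.
have n0 : (0 < n)%N by rewrite -Vn; apply/card_gt0P; exists s.
set q : R := Num.sqrt n%:R.
have q1 : 1 <= q by rewrite -[1]sqrtr1 ler_sqrt ?ler1n // ltr0n.
have qq : n%:R = q * q by rewrite -expr2 sqr_sqrtr ?ler0n.
have pow (m : nat) : (n%:R : R) `^ ((m.*2.+1)%:R / 2) = n%:R ^+ m * q.
  have -> : (m.*2.+1)%:R / 2 = m%:R + 2^-1 :> R.
    by rewrite -addn1 natrD -muln2 natrM mulrDl mulfK ?pnatr_eq0 // mul1r.
  rewrite powRD ?powR_mulrn ?powR12_sqrt ?ler0n //.
  by rewrite pnatr_eq0 -lt0n n0 implybT.
have {}nL : 12 * (n%:R ^+ 3 * q) + 4 * n%:R <= L%:R :> R by rewrite -(pow 3%N).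
rewrite (pow 1%N) expr1.
have N0 : 0 < n%:R :> R by rewrite ltr0n.
have N3 : 0 < n%:R ^+ 3 * q :> R by rewrite mulr_gt0 ?exprn_gt0 // (lt_le_trans ltr01).
have L0 : (0 < L)%N by rewrite -(ltr_nat R); lra.
(* Beyond the lifetime the first snapshot is repeated, so that [E t] is connected for all [t]. *)
pose E t := adj (tnth G (insubd (Ordinal L0) t)).
have EG (i : 'I_L) : E i =2 tnth G i by move=> x y; rewrite /E valKd.
have E_sym t : symmetric (E t) by apply: adj_sym.
have E_conn t x y : connect (E t) x y by apply: G_conn.
suff [T [l [TL lq [J [y [t sJ v]]]]]] : exists T l : nat, [/\ (T <= L)%N,
    l%:R <= 200 * (n%:R * q) & tour E [set: V] 0 s T l].
  have [J' [jo vi sz]] := trip_journey EG (trip_leq_end TL t).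
  exists J'; split; last by apply: le_trans lq; rewrite ler_nat sz.
  by split; [exists y | move=> w; rewrite vi v].
(* From [n >= 50] on, [300 * n ^ 2 * k] with [k <= 2 * q] is at most [12 * n ^ 3 * q]. *)
have [n50|n50] := ltnP n 50.
  exists (n * n)%N, (n * n)%N; split.
  - rewrite -(ler_nat R); apply: le_trans nL; rewrite natrM.
    have : n%:R * n%:R * 1 <= n%:R * n%:R * (n%:R * q) :> R.
      by rewrite ler_wpM2l ?mulr_ege1 ?ler1n // mulr_ge0 ?ler0n.
    by rewrite !exprS expr0 mulr1 !mulrA; lra.
  - have N50 : n%:R < 50 :> R by rewrite ltr_nat.
    have q50 : q <= 50 by nra.
    rewrite natrM {2}qq [leRHS]mulrCA ler_wpM2l ?ler0n //; nra.
  - by have := tour_naive E_conn [set: V] 0 s; rewrite cardsT Vn.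
(* The least such [k] satisfies [k - 1 < q], and [1 <= q]. *)
have [k [nk kq]] : exists k : nat, (n <= k ^ 2)%N /\ k%:R <= 2 * q.
  have [|k nk kmin] := @ex_minnP (fun k => n <= k ^ 2)%N; first by exists n; nia.
  exists k; split=> //.
  case: k nk kmin => [|k] nk kmin; first by rewrite mulr_ge0 // (le_trans ler01).
  have kn : (k ^ 2 < n)%N by rewrite ltnNge; apply/negP => /kmin; rewrite ltnn.
  have : k%:R * k%:R <= q * q :> R by rewrite -qq -natrM ler_nat; nia.
  rewrite -natr1; have : 0 <= k%:R :> R by rewrite ler0n.
  by clear -q1; nra.
exists (300 * n ^ 2 * k)%N, (100 * n * k)%N; split.
- rewrite -(ler_nat R); apply: le_trans nL; rewrite !natrM.
  have N50 : 50 <= n%:R :> R by rewrite ler_nat.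
  have h1 : n%:R * n%:R * k%:R <= n%:R * n%:R * (2 * q) :> R.
    by rewrite ler_wpM2l // mulr_ge0 ?ler0n.
  have h2 : 50 * (n%:R * n%:R * q) <= n%:R * (n%:R * n%:R * q) :> R.
    by rewrite ler_wpM2r // !mulr_ge0 ?ler0n // (le_trans ler01).
  by move: h1 h2; rewrite !exprS expr0 mulr1 !mulrA; lra.
- rewrite !natrM -mulrA; have : n%:R * k%:R <= n%:R * (2 * q) by rewrite ler_wpM2l ?ler0n.
  by rewrite mulrCA; lra.
by rewrite -Vn; apply: tour_square => //; rewrite cardsT Vn.
Qed.
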